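(* Let $1\le s\le r/2$, and suppose that $H$ is an $s$-connected $r$-uniform hypergraph on a finite vertex set $V$. Let $\lambda_1^{(s)}$ and $\lambda_{\max}^{(s)}$ be the first non-trivial and the last eigenvalue of the $s$-th Laplacian $\mathcal L^{(s)}$ of $H$. For $0\le\alpha<1$, the joint distribution $f_k$ at the $k$-th stop of the $\alpha$-lazy random $s$-walk on $H$ at time $k$ converges to the stationary distribution $\pi$ in probability. In particular, $$\|(f_k-\pi)T^{-1/2}\|\le(\bar\lambda_\alpha^{(s)})^k\,\|(f_0-\pi)T^{-1/2}\|,$$ where $$\bar\lambda_\alpha^{(s)}=\max\{|1-(1-\alpha)\lambda_1^{(s)}|,\ |(1-\alpha)\lambda_{\max}^{(s)}-1|\}$$ and $f_0$ is the probability distribution at the initial stop.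
   Context: $V^{\underline{s}}$ is the set of ordered $s$-tuples of distinct elements of $V$; for $x\in V^{\underline{s}}$, $[x]$ is the $s$-set of its coordinates. An $r$-uniform hypergraph $H$ has edge set $E(H)\subseteq\binom{V}{r}$. For $S\subseteq V$ with $|S|<r$, $d_S$ is the number of edges containing $S$, and $\Gamma(S)=\{U: S\cap U=\emptyset,\ S\cup U\in E(H)\}$. An $s$-walk of length $k$ is a sequence of vertices $v_1,\dots,v_{(r-s)(k-1)+r}$ such that $F_i=\{v_{(r-s)(i-1)+1},\dots,v_{(r-s)(i-1)+r}\}$ is an edge of $H$ for $1\le i\le k$. Its $i$-th stop ($0\le i\le k$) is the ordered $s$-tuple $x_i=(v_{(r-s)i+1},\dots,v_{(r-s)i+s})$; it starts at $x_0$ and ends at $x_k$. It is an $s$-path if all its stops are different. $H$ is $s$-connected if for every $x,y\in V^{\underline{s}}$ there is an $s$-path from $x$ to $y$. A random $s$-walk: at each step, if $S$ is the set of the last $s$ vertices of the current sequence (the current stop), a random $(r-s)$-set is chosen uniformly from $\Gamma(S)$ and its vertices are appended one by one in random order. The $\alpha$-lazy random $s$-walk stays at the current stop with probability $\alpha$ and with probability $1-\alpha$ makes a step of the random $s$-walk. For $1\le s\le r/2$, $G^{(s)}$ is the weighted undirected graph on $V^{\underline{s}}$ with $w(x,y)=|\{F\in E(H):[x]\cup[y]\subseteq F\}|$ if $[x]\cap[y]=\emptyset$ and $w(x,y)=0$ otherwise. The degree of $x$ is $d_x=\sum_y w(x,y)=d_{[x]}\binom{r-s}{s}s!$. Restricted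 to its stops, the $\alpha$-lazy random $s$-walk is the $\alpha$-lazy random walk on $G^{(s)}$, with transition probabilities $\alpha$ for $x\to x$ and $(1-\alpha)w(x,y)/d_x$ for $x\to y\ne x$. Let $A=(w(x,y))$ and $T=\mathrm{diag}(d_x)$; the $s$-th Laplacian is $\mathcal L^{(s)}=I-T^{-1/2}AT^{-1/2}$, with eigenvalues listed in non-decreasing order as $\lambda_0^{(s)}\le\lambda_1^{(s)}\le\cdots\le\lambda_{\max}^{(s)}$. The stationary distribution is $\pi(x)=d_x/\sum_{y}d_y$. Distributions are row vectors; $\|\cdot\|$ is the Euclidean norm.
   Formalization: Convergence of f_k to π is claimed except when α=0, r=2s and λ_max=2 together, where it fails (e.g. H=K_2, s=1: the walk alternates); the norm bound holds for all 0≤α<1. At least two s-tuples of distinct vertices are assumed so that λ_1 exists. *)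

(* Defs.v *)
From mathcomp Require Import all_boot all_order all_algebra.
From mathcomp Require Import reals polyrcf.

Set Implicit Arguments.
Unset Strict Implicit.
Unset Printing Implicit Defensive.

Import Order.TTheory GRing.Theory Num.Theory.

Local Open Scope ring_scope.

(* Ordered s-tuples of distinct elements of V, and [x] for such a tuple x. *)
Notation stops V s := {t : s.-tuple V | uniq t}.

Definition tset (V : finType) (s : nat) (x : stops V s) : {set V} :=
  [set v in val x].

Section Hypergraph.
Variables (V : finType) (E : {set {set V}}) (r s : nat).

Definition r_uniform : Prop := forall F : {set V}, F \in E -> #|F| = r.

(* Sequences are indexed from 0 here, so walk_edge v i is F_(i+1). *)
Definition walk_edge (v : seq V) (i : nat) : {set V} :=
  [set a in take r (drop ((r - s) * i) v)].

Definition walk_stop (v : seq V) (i : nat) : seq V :=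
  take s (drop ((r - s) * i) v).

(* The length (r - s)(k - 1) + r is written (r - s) k + s, which avoids the
   truncated k - 1; a walk of length 0 is a single stop. *)
Definition s_walk (k : nat) (v : seq V) : Prop :=
  size v = ((r - s) * k + s)%N /\
  forall i : nat, (i < k)%N -> walk_edge v i \in E.

Definition s_path (k : nat) (v : seq V) : Prop :=
  s_walk k v /\ uniq [seq walk_stop v i | i <- iota 0 k.+1].

Definition s_connected : Prop :=
  forall x y : stops V s, exists k : nat, exists v : seq V,
    [/\ s_path k v, walk_stop v 0 = val x & walk_stop v k = val y].

Definition link (S : {set V}) : {set {set V}} :=
  [set U : {set V} | [disjoint S & U] && (S :|: U \in E)].

Definition weight (x y : stops V s) : nat :=
  if [disjoint tset x & tset y]
  then #|[set F in E | tset x :|: tset y \subset F]| else 0%N.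

Definition degree (x : stops V s) : nat := (\sum_y weight x y)%N.

End Hypergraph.

Section Walk.
Variables (R : realType) (V : finType) (E : {set {set V}}) (r s : nat).

(* Probability that one step of the random s-walk leads from the stop x to the
   stop y: U is uniform in the link of [x], u is a uniform ordering of U, and
   y must be the last s vertices of the sequence x followed by u. *)
Definition step_prob (x y : stops V s) : R :=
  \sum_(U in link E (tset x)) (#|link E (tset x)|%:R)^-1 *
    \sum_(u : stops V (r - s) | tset u == U)
      ((r - s)`!%:R)^-1 *
      (drop (r - s) (tval (val x) ++ tval (val u)) == tval (val y))%:R.

Definition lazy_step_prob (alpha : R) (x y : stops V s) : R :=
  alpha * (x == y)%:R + (1 - alpha) * step_prob x y.

(* Matrices and row vectors over stops are indexed through enum_val. *)
Local Notation N := #|{: stops V s}|.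

Definition transition_mx (alpha : R) : 'M[R]_N :=
  \matrix_(i, j) lazy_step_prob alpha (enum_val i) (enum_val j).

Definition stop_distribution (alpha : R) (f0 : 'rV[R]_N) (k : nat) : 'rV[R]_N :=
  iter k (fun f => f *m transition_mx alpha) f0.

Definition is_distribution (f : 'rV[R]_N) : Prop :=
  (forall i, 0 <= f 0 i) /\ \sum_i f 0 i = 1.

Definition stationary : 'rV[R]_N :=
  \row_i ((degree E (enum_val i))%:R / (\sum_(y : stops V s) degree E y)%N%:R).

Definition adjacency_mx : 'M[R]_N :=
  \matrix_(i, j) (weight E (enum_val i) (enum_val j))%:R.

(* T^{-1/2} *)
Definition inv_sqrt_degree_mx : 'M[R]_N :=
  diag_mx (\row_i (Num.sqrt (degree E (enum_val i))%:R)^-1).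

Definition laplacian : 'M[R]_N :=
  1%:M - inv_sqrt_degree_mx *m adjacency_mx *m inv_sqrt_degree_mx.

End Walk.

(* Real eigenvalues in non-decreasing order, repeated according to algebraic
   multiplicity; for a symmetric matrix this is the whole spectrum. *)
Definition eigenvalues (R : realType) (n : nat) (M : 'M[R]_n) : seq R :=
  flatten [seq nseq (mup a (char_poly M)) a | a <- rootsR (char_poly M)].

Definition lambda1 (R : realType) (V : finType) (E : {set {set V}}) (s : nat)
  : R := nth 0 (eigenvalues (laplacian R E s)) 1.

Definition lambda_max (R : realType) (V : finType) (E : {set {set V}}) (s : nat)
  : R := last 0 (eigenvalues (laplacian R E s)).

Definition lambda_bar (R : realType) (V : finType) (E : {set {set V}}) (s : nat)
  (alpha : R) : R :=
  Num.max `|1 - (1 - alpha) * lambda1 R E s|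
          `|(1 - alpha) * lambda_max R E s - 1|.

(* The library norm on row vectors is the sup norm. *)
Definition euclid_norm (R : realType) (n : nat) (v : 'rV[R]_n) : R :=
  Num.sqrt (\sum_i v 0 i ^+ 2).

(* Main.v *)
(* Restricted to its stops, the walk is the lazy random walk on the weighted
   graph G^(s), so (f_(k+1) - pi) T^(-1/2) is obtained from (f_k - pi) T^(-1/2)
   by applying I - (1 - alpha) L.  In an orthonormal eigenbasis of L this
   multiplies the coordinate of eigenvalue l by 1 - (1 - alpha) l.  The
   coordinate of eigenvalue 0 vanishes: by connectedness the kernel of L is
   spanned by the square roots of the degrees, and f_k - pi has total mass 0.
   All other eigenvalues lie between lambda_1 and lambda_max, which gives the
   contraction.  For convergence one needs lambda_bar < 1, where only
   alpha = 0, lambda_max = 2 could go wrong: then some nonzero function changes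
   sign along every edge of G^(s), which for r > 2s is impossible inside a
   single hyperedge.
   The eigenbasis is taken over the complex numbers R[i]. *)
Require Import Defs.
From mathcomp Require Import all_boot all_order all_algebra.
From mathcomp Require Import polyrcf complex reals ring lra zify.

Set Implicit Arguments.
Unset Strict Implicit.
Unset Printing Implicit Defensive.

Import Order.TTheory GRing.Theory Num.Theory.

Local Open Scope ring_scope.

(** * Steps, weights and connectedness of the hypergraph *)

Section Hypergraph.
Variable V : finType.
Implicit Types (E : {set {set V}}) (r s : nat).

Lemma card_tset s (x : stops V s) : #|tset x| = s.
Proof. by rewrite cardsE; have /card_uniqP-> := valP x; rewrite size_tuple. Qed.

Lemma in_tset s (x : stops V s) v : (v \in tset x) = (v \in tval (val x)).
Proof. by rewrite inE. Qed.

(* inE alone would unfold tset to membership in a tuple, hiding tval. *)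
Let inT := (in_tset, inE).

Lemma stop_of_seq s (l : seq V) : size l = s -> uniq l ->
  exists x : stops V s, tval (val x) = l.
Proof.
move=> sl ul; have st : size l == s by apply/eqP.
by exists (Sub (Tuple st) ul : stops V s).
Qed.

Lemma stop_val_inj s (x y : stops V s) : tval (val x) = tval (val y) -> x = y.
Proof. by move=> xy; apply/val_inj/val_inj. Qed.

Lemma stop_in_set s (A : {set V}) : (s <= #|A|)%N ->
  exists x : stops V s, tset x \subset A.
Proof.
move=> sA; have [||x xE] := @stop_of_seq s (take s (enum A)).
- by rewrite size_takel // -cardE.
- by rewrite take_uniq // enum_uniq.
by exists x; apply/subsetP => v; rewrite inT xE => /mem_take; rewrite mem_enum.
Qed.

(** Cutting off the prescribed suffix [y] is a bijection onto the orderings of [A :\: tset y], a set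
    of [n - s] vertices. *)
Lemma card_stops_suffix n s (A : {set V}) (y : stops V s) :
  (s <= n)%N -> #|A| = n -> tset y \subset A ->
  #|[set u : stops V n | (tset u == A) &&
       (drop (n - s) (tval (val u)) == tval (val y))]| = (n - s)`!.
Proof.
move=> sn cA yA; set B := [set u | _]; set m := (n - s)%N.
have mE : minn m n = m by apply/minn_idPl; exact: leq_subr.
pose g (u : stops V n) := tcast mE [tuple of take m (val u)].
have gE u : tval (g u) = take m (val u) by rewrite val_tcast.
have injg : {in B &, injective g}.
  move=> u u'; rewrite !inT => /andP[_ /eqP du] /andP[_ /eqP du'] guu'.
  apply: stop_val_inj; rewrite -(cat_take_drop m (val u)).
  by rewrite -(cat_take_drop m (val u')) du du' -!gE guu'.
rewrite -(card_in_imset injg).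
have cAy : #|A :\: tset y| = m.
  by rewrite cardsD (setIidPr yA) card_tset cA.
rewrite -[RHS](ffactnn m) -[X in (X ^_ _)%N]cAy -card_uniq_tuples.
apply: eq_card => t; rewrite inT; apply/imsetP/andP.
  case=> u; rewrite inT => /andP[/eqP uA /eqP uy] ->; rewrite gE.
  have := valP u; rewrite -{1}(cat_take_drop m (val u)) cat_uniq uy.
  move=> /and3P[ut /hasPn uty _]; split=> //; apply/allP => v vt; change (v \in A :\: tset y).
  rewrite in_setD -uA !in_tset (mem_take vt) andbT.
  by apply/negP => vy; have := uty v vy; rewrite vt.
case=> /allP tA ut.
have [||u uE] := @stop_of_seq n (t ++ val y).
- by rewrite size_cat !size_tuple subnK.
- rewrite cat_uniq ut (valP y) andbT; apply/hasPn => v vy; apply/negP => vt.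
  by have : v \in A :\: tset y := tA v vt; rewrite in_setD in_tset vy.
exists u; last by apply: val_inj; rewrite -[RHS]/(tval (g u)) gE uE take_size_cat ?size_tuple.
rewrite inT uE drop_size_cat ?size_tuple // eqxx andbT.
rewrite eqEcard card_tset cA leqnn andbT; apply/subsetP => v.
rewrite in_tset uE mem_cat => /orP[/tA|vy].
  by rewrite -[_ v]/(v \in A :\: tset y) => /setDP[].
by apply: (subsetP yA); rewrite inT.
Qed.

Lemma card_orderings n (A : {set V}) : #|A| = n ->
  #|[set u : stops V n | tset u == A]| = n`!.
Proof.
move=> cA; have [y yE] := @stop_of_seq 0 [::] erefl isT.
have y0 : tset y \subset A by apply/subsetP => v; rewrite inT yE.
rewrite -[in RHS](subn0 n) -(card_stops_suffix (leq0n n) cA y0).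
by apply: eq_card => u; rewrite !inT yE subn0 drop_oversize ?andbT // size_tuple.
Qed.

(** * Weights of [G^(s)] and one-step probabilities *)

Lemma weight_sym E s (x y : stops V s) : weight E x y = weight E y x.
Proof. by rewrite /weight disjoint_sym setUC. Qed.

Lemma weight_gt0P E s (x y : stops V s) :
  reflect (exists2 F, F \in E &
    [/\ [disjoint tset x & tset y], tset x \subset F & tset y \subset F])
    (0 < weight E x y)%N.
Proof.
apply: (iffP idP) => [|[F FE [xy xF yF]]].
  rewrite /weight; case: ifP => // xy /card_gt0P[F].
  by rewrite inT subUset => /and3P[FE xF yF]; exists F.
rewrite /weight xy; apply/card_gt0P; exists F.
by rewrite inT FE subUset xF yF.
Qed.

(** Since [s <= r - s], the new stop lies entirely inside the appended block [u]. The blocks are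
    grouped by the edge they complete: an edge [F] containing both disjoint stops contributes the
    orderings of [F :\: tset x] that end in [y], any other edge contributes none. *)
Lemma card_steps E r s (x y : stops V s) : (s.*2 <= r)%N -> r_uniform E r ->
  #|[set u : stops V (r - s) | (tset u \in link E (tset x)) &&
       (drop (r - s) (tval (val x) ++ tval (val u)) == tval (val y))]| =
  ((r - s - s)`! * weight E x y)%N.
Proof.
move=> sr Er; have s_le : (s <= r - s)%N by lia.
have dropE (u : stops V (r - s)) :
    drop (r - s) (tval (val x) ++ tval (val u)) = drop (r - s - s) (tval (val u)).
  by rewrite drop_cat size_tuple ltnNge s_le.
rewrite -sum1_card.
rewrite (partition_big (fun u => tset x :|: tset u) (mem E)) /=; last first.
  by move=> u; rewrite !inT => /andP[/andP[]].
rewrite /weight; case: ifP => xy; last first.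
  rewrite muln0 big1 // => F FE; rewrite big_pred0 // => u.
  rewrite !inT dropE; apply/negP => /andP[/andP[/andP[xu _] /eqP uy] _].
  move/negP: xy; apply; apply: disjointWr xu.
  by apply/subsetP => v; rewrite !inT -uy => /mem_drop.
rewrite mulnC -sum_nat_const big_mkcond [RHS]big_mkcond /=.
apply: eq_bigr => F _; rewrite inT; case: ifP => //= FE.
case: ifP => xyF; last first.
  rewrite big_pred0 // => u.
  rewrite !inT dropE; apply/negP => /andP[/andP[_ /eqP uy] /eqP uF].
  move/negP: xyF; apply; rewrite -uF setUS //.
  by apply/subsetP => v; rewrite !inT -uy => /mem_drop.
move: xyF; rewrite subUset => /andP[xF yF].
have cF : #|F :\: tset x| = (r - s)%N.
  by rewrite cardsD (setIidPr xF) card_tset (Er _ FE).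
have yFx : tset y \subset F :\: tset x by rewrite subsetD yF disjoint_sym.
rewrite -(card_stops_suffix s_le cF yFx) -sum1_card; apply: eq_bigl => u.
rewrite !inT dropE; apply/idP/idP.
  move=> /andP[/andP[/andP[xu _] ->] /eqP <-]; rewrite andbT.
  by rewrite setDUl setDv set0U; apply/eqP/esym/setDidPl; rewrite disjoint_sym.
move=> /andP[/eqP uE ->]; rewrite uE andbT setDE setUIr setUCr setIT.
rewrite (setUidPr xF) FE eqxx !andbT -setDE.
by rewrite -setI_eq0 setDE setICA setICr setI0.
Qed.

(* Both sides count the continuations of x, by their last s vertices and by their
   underlying set. *)
Lemma card_extensions E r s (x : stops V s) : (s.*2 <= r)%N -> r_uniform E r ->
  ((r - s - s)`! * degree E x = #|link E (tset x)| * (r - s)`!)%N.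
Proof.
move=> sr Er; rewrite /degree big_distrr /=.
under eq_bigr do rewrite -card_steps // -sum1_card.
transitivity (\sum_(u : stops V (r - s) | tset u \in link E (tset x)) 1)%N.
  rewrite (exchange_big_dep (fun u : stops V (r - s) => tset u \in link E (tset x))) /=;
    last by move=> y u _; rewrite !inT => /andP[].
  apply: eq_bigr => u ux.
  have [||y yE] := @stop_of_seq s (drop (r - s) (tval (val x) ++ tval (val u))).
  - by rewrite size_drop size_cat !size_tuple; lia.
  - rewrite drop_cat size_tuple ltnNge (_ : s <= r - s)%N; last lia.
    by rewrite drop_uniq // (valP u).
  rewrite (big_pred1 y) // => z; rewrite inT ux /= -yE.
  by apply/eqP/eqP => [/stop_val_inj->|->].
rewrite (partition_big (fun u => tset u) (mem (link E (tset x)))) //=.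
rewrite -sum_nat_const; apply: eq_bigr => U Ux.
have cU : #|U| = (r - s)%N.
  move: Ux; rewrite inT => /andP[xU /Er].
  rewrite cardsU (disjoint_setI0 xU) cards0 subn0 card_tset; lia.
rewrite -(card_orderings cU) -sum1_card; apply: eq_bigl => u.
by rewrite !inT; case: eqP => [->|]; rewrite ?andbF // andbT; move: Ux; rewrite inT.
Qed.

(** A uniform set from the link in uniform order makes all continuations equally likely, so the
    probability is a quotient of the counts in [card_steps] and [card_extensions]; the factor
    [(r - 2s)!] cancels. *)
Lemma step_probE (R : realType) E r s (x y : stops V s) :
  (s.*2 <= r)%N -> r_uniform E r -> (0 < degree E x)%N ->
  step_prob R E r x y = (weight E x y)%:R / (degree E x)%:R.
Proof.
move=> sr Er dx; have ext := card_extensions x sr Er.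
have m0 : (0 < (r - s - s)`!)%N by exact: fact_gt0.
have n0 : (0 < (r - s)`!)%N by exact: fact_gt0.
(* A positive degree makes the link nonempty, so the inverse of its size is genuine. *)
have K0 : (0 < #|link E (tset x)|)%N.
  by move: (muln_gt0 (r - s - s)`! (degree E x)); rewrite m0 dx ext muln_gt0 => /andP[].
rewrite /step_prob.
transitivity ((#|link E (tset x)|%:R * (r - s)`!%:R)^-1 *
  ((r - s - s)`! * weight E x y)%N%:R : R).
  rewrite -card_steps // -[X in _ * X%:R]sum1_card natr_sum.
  rewrite (partition_big (fun u => tset u) (mem (link E (tset x)))) /=; last first.
    by move=> u; rewrite inT => /andP[].
  rewrite mulr_sumr; apply: eq_bigr => U Ux.
  rewrite invfM -mulrA; congr (_ * _); rewrite mulr_sumr.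
  rewrite [RHS]big_mkcond [LHS]big_mkcond /=; apply: eq_bigr => u _.
  rewrite inT; case: (tset u =P U) => [->|_]; last by rewrite andbF.
  by rewrite Ux andbT /=; case: eqP; rewrite ?mulr0 ?mulr1.
rewrite -natrM -ext !natrM; field.
by rewrite !pnatr_eq0 -!lt0n m0 dx.
Qed.

(** * Walks, connectedness and sign changes along edges *)

Lemma disjoint_take_drop (l : seq V) (i j : nat) : uniq l -> (i <= j)%N ->
  [disjoint [set v in take i l] & [set v in drop j l]].
Proof.
move=> ul ij; rewrite -setI_eq0; apply/eqP/setP => v; rewrite !inT.
apply/negP => /andP[vt vd]; move: ul; rewrite -(cat_take_drop i l) cat_uniq.
move=> /and3P[_ /hasPn/(_ v) nt _].
have /nt : v \in drop i l by move: vd; rewrite -(subnK ij) -drop_drop => /mem_drop.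
by rewrite /= vt.
Qed.

(** Consecutive stops are the first and the last [s] vertices of one edge, and [2s <= r] keeps them
    disjoint. *)
Lemma walk_step E r s k (v : seq V) i :
  (s.*2 <= r)%N -> r_uniform E r -> s_walk E r s k v -> (i < k)%N ->
  exists a b : stops V s, [/\ tval (val a) = walk_stop r s v i,
    tval (val b) = walk_stop r s v i.+1 & (0 < weight E a b)%N].
Proof.
move=> sr Er [_ vE] /vE; rewrite /walk_edge; set e := take r _ => eE.
have ce : #|e| = r by have := Er _ eE; rewrite cardsE.
have se : size e = r.
  apply/eqP; rewrite eqn_leq -{2}ce card_size andbT size_take.
  by case: ltnP.
(* Distinctness comes from uniformity: the [r] entries of [e] form a set of [r] elements. *)
have ue : uniq e by apply/card_uniqP; rewrite ce se.
have s0E : walk_stop r s v i = take s e.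
  by rewrite /walk_stop /e take_takel //; lia.
have s1E : walk_stop r s v i.+1 = drop (r - s) e.
  rewrite /walk_stop mulnS -drop_drop take_drop /e; congr (drop _ (take _ _)).
  lia.
have [||a aE] := @stop_of_seq s (take s e).
- by rewrite size_takel // se; lia.
- exact: take_uniq.
have [||b bE] := @stop_of_seq s (drop (r - s) e).
- by rewrite size_drop se; lia.
- exact: drop_uniq.
exists a, b; rewrite s0E s1E; split=> //; apply/weight_gt0P.
have ta : tset a = [set c in take s e] by apply/setP => c; rewrite in_tset aE inE.
have tb : tset b = [set c in drop (r - s) e].
  by apply/setP => c; rewrite in_tset bE inE.
exists [set a in e] => //; rewrite ta tb; split.
- by apply: disjoint_take_drop => //; lia.
- by apply/subsetP => c; rewrite !inT => /mem_take.
- by apply/subsetP => c; rewrite !inT => /mem_drop.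
Qed.

(** The value of [h] is carried along the stops of an [s]-path. This is the form in which
    connectedness enters the spectral argument. *)
Lemma connected_const E r s (T : Type) (h : stops V s -> T) :
  (s.*2 <= r)%N -> r_uniform E r -> s_connected E r s ->
  (forall x y, (0 < weight E x y)%N -> h x = h y) -> forall x y, h x = h y.
Proof.
move=> sr Er Ec hE x y; have [k [v [[vw _] v0 vk]]] := Ec x y.
suff H i : (i <= k)%N -> forall z : stops V s,
    tval (val z) = walk_stop r s v i -> h x = h z.
  exact: H k (leqnn k) y (esym vk).
elim: i => [_ z|i IHi ik z zE]; first by rewrite v0 => /stop_val_inj->.
have [a [b [aE bE wab]]] := walk_step sr Er vw ik.
rewrite (IHi (ltnW ik) a aE) (hE _ _ wab); congr h.
by apply: stop_val_inj; rewrite bE zE.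
Qed.

(** The first step of a path from [x] to a different stop is an edge of [G^(s)]. This makes all
    degrees positive. *)
Lemma connected_neighbor E r s (x : stops V s) :
  (s.*2 <= r)%N -> r_uniform E r -> s_connected E r s ->
  (1 < #|{: stops V s}|)%N -> exists y, (0 < weight E x y)%N.
Proof.
move=> sr Er Ec /card_gt1P[y1 [y2 [_ _ y12]]].
have [y xy] : exists y, x != y.
  have [x1|x1] := eqVneq x y1; last by exists y1.
  by exists y2; rewrite x1.
have [[|k] [v [[vw _] v0 vk]]] := Ec x y.
  by case/eqP: xy; apply: stop_val_inj; rewrite -v0 -vk.
have [a [b [aE _ wab]]] := walk_step sr Er vw (ltn0Sn k).
by exists b; rewrite (_ : x = a) //; apply: stop_val_inj; rewrite aE v0.
Qed.

Lemma degree_gt0 E s (x y : stops V s) : (0 < weight E x y)%N ->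
  (0 < degree E x)%N.
Proof. by rewrite /degree (bigD1 y) //= addn_gt0 => ->. Qed.

(** Two stops with a common neighbour have equal values. A chain of such pairs inside one edge leads
    from [x] to a neighbour [y], so [h x = h y = - h x]. This excludes eigenvalue 2 when
    [2s < r]. *)
Lemma not_alternating E r s (R : numDomainType) (h : stops V s -> R) :
  (s.*2 < r)%N -> r_uniform E r ->
  (forall x : stops V s, exists y, (0 < weight E x y)%N) ->
  (forall x y, (0 < weight E x y)%N -> h x = - h y) -> forall x, h x = 0.
Proof.
move=> sr Er En hE x; have [y wxy] := En x.
have [F FE [xy xF yF]] := weight_gt0P _ _ _ wxy.
(* z interpolates between x and y one coordinate at a time; consecutive z's
   occupy at most s + 1 vertices of F, so a stop t in F avoids both. *)
pose z i := take i (tval (val y)) ++ drop i (tval (val x)).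
have zF i v : v \in z i -> v \in F.
  rewrite mem_cat => /orP[/mem_take|/mem_drop] vz.
    by apply: (subsetP yF); rewrite inT.
  by apply: (subsetP xF); rewrite inT.
have zs i : (i <= s)%N -> exists a : stops V s, tval (val a) = z i.
  move=> si; apply: stop_of_seq.
    by rewrite size_cat size_takel ?size_drop ?size_tuple //; lia.
  rewrite cat_uniq take_uniq ?drop_uniq ?(valP x) ?(valP y) //= andbT.
  apply/hasPn => v /mem_drop vx; apply/negP => /mem_take vy.
  by move/disjoint_setI0/setP/(_ v): xy; rewrite !inT vx vy.
have H i : (i <= s)%N -> forall a : stops V s, tval (val a) = z i -> h a = h x.
  elim: i => [_ a|i IHi si a aE].
    by rewrite /z take0 drop0 => /stop_val_inj->.
  have [b bE] := zs i (ltnW si); rewrite -(IHi (ltnW si) b bE).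
  pose Z := [set v in take i.+1 (tval (val y)) ++ drop i (tval (val x))].
  have cZ : (#|Z| <= s.+1)%N.
    rewrite cardsE (leq_trans (card_size _)) //.
    by rewrite size_cat size_drop size_takel ?(size_tuple (val y)) ?size_tuple //; lia.
  (* Here [2s < r] enters, as [r - (s + 1) >= s]. *)
  have [|t tFZ] := @stop_in_set s (F :\: Z).
    rewrite cardsD (Er _ FE); have := subset_leq_card (subsetIr F Z); lia.
  have wt (c : stops V s) : tset c \subset F -> tset c \subset Z -> h c = - h t.
    move=> cF cZ'; apply: hE; apply/weight_gt0P; exists F => //; split=> //.
      rewrite disjoint_sym; apply: disjointWr cZ' _; move: tFZ.
      by rewrite subsetD => /andP[].
    by move: tFZ; rewrite subsetD => /andP[].
  rewrite (wt a) ?(wt b) //; apply/subsetP => v; rewrite !inT ?aE ?bE.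
  - exact: zF.
  - rewrite !mem_cat => /orP[vy|->]; last by rewrite orbT.
    by apply/orP; left; move: vy; rewrite -(@take_takel _ i i.+1) // => /mem_take.
  - exact: zF.
  - rewrite !mem_cat => /orP[->//|]; rewrite -add1n -drop_drop => /mem_drop ->.
    by rewrite orbT.
have hy : h y = h x.
  apply: (H s) => //; rewrite /z take_oversize ?drop_oversize ?cats0 ?size_tuple //.
have /eqP := hE _ _ wxy; rewrite hy -addr_eq0 -mulr2n mulrn_eq0 /=.
by move=> /eqP.
Qed.

End Hypergraph.

(** * Real symmetric matrices *)

Lemma char_poly_conj (F : fieldType) n (P A : 'M[F]_n) : P \in unitmx ->
  char_poly (invmx P *m A *m P) = char_poly A.
Proof.
move=> Pu; rewrite /char_poly.
have -> : char_poly_mx (invmx P *m A *m P) =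
    map_mx polyC (invmx P) *m char_poly_mx A *m map_mx polyC P.
  rewrite /char_poly_mx mulmxBr mulmxBl scalar_mxC -['X%:M *m _ *m _]mulmxA -!map_mxM.
  by rewrite mulVmx // map_mx1 mulmx1.
by rewrite !det_mulmx mulrAC -det_mulmx -map_mxM mulVmx // map_mx1 det1 mul1r.
Qed.

Section Spectral.
Variable R : realType.
Local Notation C := R[i]%C.
Local Notation toC := (real_complex R).
Local Open Scope sesquilinear_scope.

Lemma sqnorm_unitary n (P : 'M[C]_n) (u : 'rV[C]_n) : P \is unitarymx ->
  \sum_i `|(u *m P) 0 i| ^+ 2 = \sum_i `|u 0 i| ^+ 2.
Proof.
have sqE (v : 'rV[C]_n) : \sum_i `|v 0 i| ^+ 2 = (v *m v^t*) 0 0.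
  by rewrite mxE; apply: eq_bigr => i _; rewrite !mxE normCK.
move=> Pu; rewrite !sqE trmx_mul map_mxM mulmxA.
by rewrite -[u *m P *m _]mulmxA (unitarymxP Pu) mulmx1.
Qed.

(** Over [R[i]] a real symmetric matrix is Hermitian, hence normal, with real spectral diagonal. The
    rows of [P] are orthonormal eigenvectors. *)
Lemma symmetric_spectral n (M : 'M[R]_n) : M^T = M ->
  exists P : 'M[C]_n, exists d : 'rV[R]_n, P \is unitarymx /\
    map_mx toC M = P^t* *m diag_mx (map_mx toC d) *m P.
Proof.
move=> Msym; set A := map_mx toC M.
have Areal : A \is a realmx.
  by apply/mxOverP => i j; rewrite mxE; apply/complex_realP; exists (M i j).
have Aherm : A \is hermsymmx.
  apply: realsym_hermsym => //; apply/is_hermitianmxP.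
  by rewrite expr0 scale1r map_mx_id // map_trmx Msym.
have Pu := spectral_unitarymx A.
have /orthomx_spectralP AE := hermitian_normalmx Aherm.
have dreal := hermitian_spectral_diag_real Aherm.
exists (spectralmx A), (map_mx (@complex.Re R) (spectral_diag A)); split=> //.
rewrite -invmx_unitary // -map_mx_comp [map_mx _ (spectral_diag A)]map_mx_id_in //.
by move=> i j /=; apply: RRe_real; exact: (mxOverP dreal).
Qed.

Lemma sorted_eigenvalues n (M : 'M[R]_n) : sorted <=%R (eigenvalues M).
Proof.
rewrite /eigenvalues.
have : sorted <%R (rootsR (char_poly M)) by exact: sorted_roots.
elim: (rootsR _) => //= a l IHl; rewrite path_sortedE; last exact: lt_trans.
move=> /andP[al sl]; have {}IHl := IHl sl; set fl := flatten _ in IHl *.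
have afl : all (>= a) fl.
  apply/allP => b /flatten_mapP[c cl /nseqP[-> _]].
  by apply: ltW; move/allP: al; apply.
elim: (mup _ _) => //= k IHk; rewrite path_sortedE; last exact: le_trans.
by rewrite IHk andbT all_cat afl andbT; apply/allP => b /nseqP[-> _].
Qed.

(** Both lists contain each number as often as its multiplicity as a root of the characteristic
    polynomial, which splits into the factors [X - d_i]. *)
Lemma perm_eigenvalues n (M : 'M[R]_n) (P : 'M[C]_n) (d : 'rV[R]_n) :
  P \is unitarymx -> map_mx toC M = P^t* *m diag_mx (map_mx toC d) *m P ->
  perm_eq (eigenvalues M) [seq d 0 i | i : 'I_n].
Proof.
move=> Pu ME.
have charE : char_poly M = \prod_(a <- [seq d 0 i | i : 'I_n]) ('X - a%:P).
  apply: (@map_poly_inj _ _ toC); rewrite map_char_poly ME.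
  have -> : char_poly (P^t* *m diag_mx (map_mx toC d) *m P) =
            char_poly (diag_mx (map_mx toC d)).
    by rewrite -invmx_unitary // char_poly_conj // unitarymx_unit.
  rewrite char_poly_trig; last first.
    by apply: is_diag_mx_is_trig; exact: diag_mx_is_diag.
  rewrite rmorph_prod big_map big_enum /=; apply: eq_bigr => i _.
  by rewrite rmorphB /= map_polyX map_polyC /= !mxE eqxx mulr1n.
have p0 : char_poly M != 0 by rewrite monic_neq0 // char_poly_monic.
apply/allP => a _ /=; apply/eqP; rewrite -[RHS]mu_prod_XsubC -charE.
rewrite /eigenvalues count_flatten -map_comp.
have Ur : uniq (rootsR (char_poly M)) by exact: uniq_roots.
have [ra|ra] := boolP (root (char_poly M) a).
  have ain : a \in rootsR (char_poly M).
    by rewrite -(roots_on_rootsR p0) inE ra.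
  rewrite sumnE big_map (big_rem a) //= count_nseq /= eqxx mul1n big_seq big1 ?addn0 //.
  move=> b; rewrite (mem_rem_uniq _ Ur) inE => /andP[/negPf ba _] /=.
  by rewrite count_nseq /= ba.
rewrite mupNroot // sumnE big_map big_seq big1 // => b bin /=.
rewrite count_nseq /=; case: eqP => // ba; rewrite -ba in ra.
by have := roots_on_root (roots_on_rootsR p0) bin; rewrite (negPf ra).
Qed.

(** In the eigenbasis [1 - c M] multiplies coordinate [i] by [1 - c d_i], and the unitary change of
    basis preserves the norm. Each factor is either small or meets a vanishing coordinate of [g]. *)
Lemma contraction n (M : 'M[R]_n) (P : 'M[C]_n) (d g : 'rV[R]_n) (b c : R) :
  P \is unitarymx -> map_mx toC M = P^t* *m diag_mx (map_mx toC d) *m P ->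
  0 <= b ->
  (forall i, `|1 - c * d 0 i| <= b \/ \sum_j toC (g 0 j) * (P i j)^* = 0) ->
  euclid_norm (g *m (1%:M - c *: M)) <= b * euclid_norm g.
Proof.
(* The bound [b] goes under the root as [b ^+ 2], so that sums of squares are compared, in [R[i]]
   where the eigenbasis lives. *)
move=> Pu ME b0 H; rewrite /euclid_norm -[b]ger0_norm // -sqrtr_sqr -sqrtrM ?sqr_ge0 //.
apply: ler_wsqrtr; rewrite -lecR rmorphM !rmorph_sum /=.
have toCE (v : 'rV[R]_n) : \sum_i toC (v 0 i ^+ 2) = \sum_i `|map_mx toC v 0 i| ^+ 2.
  apply: eq_bigr => i _; rewrite mxE normCK rmorphXn expr2; congr (_ * _).
  exact/esym/conjc_real.
have Pt : P^t* \is unitarymx by rewrite trmxC_unitary.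
rewrite !toCE -(sqnorm_unitary (map_mx toC g) Pt).
rewrite -(sqnorm_unitary (map_mx toC (g *m (1%:M - c *: M))) Pt).
set h := map_mx toC g *m P^t*.
have -> : map_mx toC (g *m (1%:M - c *: M)) *m P^t* =
    \row_i (toC (1 - c * d 0 i) * h 0 i).
  rewrite map_mxM map_mxB map_mx1 map_mxZ ME mulmxBr mulmx1 mulmxBl -/h.
  rewrite -!scalemxAr -scalemxAl -!mulmxA (unitarymxP Pu) mulmx1 mulmxA -/h.
  apply/rowP => i; rewrite mul_mx_diag !mxE rmorphB rmorphM rmorph1 mulrBl mul1r.
  by rewrite /= -mulrA [X in toC c * X]mulrC.
rewrite mulr_sumr; apply: ler_sum => i _; rewrite mxE normrM exprMn.
have [Hi|Hi] := H i.
  apply: ler_wpM2r; first by rewrite exprn_ge0.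
  have := normc_def (toC (1 - c * d 0 i)); rewrite /= expr0n addr0 sqrtr_sqr.
  by move=> ->; rewrite rmorphXn lerXn2r ?nnegrE /= ?ler0c ?lecR.
suff -> : h 0 i = 0 by rewrite normr0 expr0n mulr0 mulr0.
by rewrite mxE -[RHS]Hi; apply: eq_bigr => j _; rewrite !mxE.
Qed.
End Spectral.

(** * The normalized Laplacian of a weighted graph *)

Section Graph.

(* Used with e = 1 and e = -1; f is an eigenfunction of the simple random walk
   with eigenvalue mu. *)
Lemma sum_sqr_difference (C : numClosedFieldType) (I : finType)
    (w : I -> I -> nat) (f : I -> C) (e mu : C) :
  (forall x y, w x y = w y x) -> e \is Num.real -> e ^+ 2 = 1 ->
  (forall y, \sum_x (w x y)%:R * f x = mu * (\sum_x w y x)%N%:R * f y) ->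
  \sum_x \sum_y (w x y)%:R * `|f x - e * f y| ^+ 2 =
    2 * (1 - e * mu) * \sum_x (\sum_y w x y)%N%:R * `|f x| ^+ 2.
Proof.
move=> wC /conj_Creal eC e2 Hf; set S := \sum_x (_ * _).
have -> : \sum_x \sum_y (w x y)%:R * `|f x - e * f y| ^+ 2 =
    \sum_x \sum_y ((w x y)%:R * `|f x| ^+ 2) +
    \sum_x \sum_y ((w x y)%:R * `|f y| ^+ 2) -
    e * (\sum_x \sum_y (w x y)%:R * f x * (f y)^* +
         \sum_x \sum_y (w x y)%:R * f y * (f x)^*).
  rewrite mulrDr !mulr_sumr -!big_split /= -sumrB; apply: eq_bigr => x _.
  rewrite !mulr_sumr -!big_split /= -sumrB; apply: eq_bigr => y _.
  rewrite !normCK rmorphB rmorphM /= eC.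
  transitivity ((w x y)%:R * (f x * (f x)^* + e ^+ 2 * (f y * (f y)^*)
      - e * (f x * (f y)^* + f y * (f x)^*))); first by ring.
  by rewrite e2; ring.
have S1 : \sum_x \sum_y ((w x y)%:R * `|f x| ^+ 2) = S.
  by apply: eq_bigr => x _; rewrite -mulr_suml natr_sum.
have S2 : \sum_x \sum_y ((w x y)%:R * `|f y| ^+ 2) = S.
  rewrite -S1 exchange_big /=; apply: eq_bigr => x _; apply: eq_bigr => y _.
  by rewrite wC.
have S3 : \sum_x \sum_y (w x y)%:R * f y * (f x)^* = mu * S.
  rewrite mulr_sumr; apply: eq_bigr => x _; rewrite -mulr_suml.
  rewrite (eq_bigr (fun y => (w y x)%:R * f y)); last by move=> y _; rewrite wC.
  by rewrite Hf normCK; ring.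
have S4 : \sum_x \sum_y (w x y)%:R * f x * (f y)^* = mu * S.
  rewrite -S3 exchange_big /=; apply: eq_bigr => x _; apply: eq_bigr => y _.
  by rewrite wC.
by rewrite S1 S2 S3 S4; ring.
Qed.

Variables (R : realType) (n : nat) (w : 'I_n -> 'I_n -> nat).
Variables (M : 'M[R]_n).
Local Notation C := R[i]%C.
Local Notation toC := (real_complex R).
Let dg i := (\sum_j w i j)%N.
Let s i : R := Num.sqrt (dg i)%:R.

Hypothesis wC : forall i j, w i j = w j i.
Hypothesis dg_gt0 : forall i, (0 < dg i)%N.
Hypothesis ME : forall i j, M i j = (i == j)%:R - (s i)^-1 * (w i j)%:R * (s j)^-1.

Lemma sqrt_dg_gt0 i : 0 < s i. Proof. by rewrite sqrtr_gt0 ltr0n. Qed.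
Lemma sqrt_dg_neq0 i : s i != 0. Proof. by rewrite gt_eqF ?sqrt_dg_gt0. Qed.
Lemma sqr_sqrt_dg i : s i ^+ 2 = (dg i)%:R. Proof. by rewrite sqr_sqrtr ?ler0n. Qed.

Lemma normalized_laplacian_sym : M^T = M.
Proof.
by apply/matrixP => i j; rewrite mxE !ME eq_sym [w j i]wC; ring.
Qed.

(** * Eigenvalues and eigenfunctions in a fixed orthonormal eigenbasis *)

Section Decomposition.
Local Open Scope sesquilinear_scope.
Variables (P : 'M[C]_n) (d : 'rV[R]_n).
Hypothesis (Pu : P \is unitarymx).
Hypothesis (PE : map_mx toC M = P^t* *m diag_mx (map_mx toC d) *m P).

(** Rescaling by [T^(-1/2)] turns an eigenvector of the Laplacian into an eigenfunction of the
    random walk. *)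
Let f i j : C := P i j / toC (s j).

(** This is entry [(i, j)] of [P M = diag(d) P], multiplied by [s j]. *)
Lemma row_eigenfunction i j :
  \sum_k (w k j)%:R * f i k = toC (1 - d 0 i) * (dg j)%:R * f i j.
Proof.
have : P *m map_mx toC M = diag_mx (map_mx toC d) *m P.
  by rewrite PE !mulmxA (unitarymxP Pu) mul1mx.
move=> /matrixP/(_ i j); rewrite mul_diag_mx !mxE => H.
have sj0 : toC (s j) != 0 by rewrite -(rmorph0 toC) (inj_eq (@complexI _)) sqrt_dg_neq0.
have E k : toC (M k j) = (k == j)%:R - (toC (s k))^-1 * (w k j)%:R * (toC (s j))^-1.
  by rewrite ME rmorphB !rmorphM !fmorphV !rmorph_nat.
have {}H : P i j - (toC (s j))^-1 * \sum_k (w k j)%:R * f i k = toC (d 0 i) * P i j.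
  rewrite -H mulr_sumr.
  transitivity (\sum_k ((P i k * (k == j)%:R) - (toC (s j))^-1 * ((w k j)%:R * f i k))).
    rewrite sumrB; congr (_ - _); rewrite (bigD1 j) //= eqxx mulr1 big1 ?addr0 //.
    by move=> k /negPf->; rewrite mulr0.
  by apply: eq_bigr => k _; rewrite !mxE E /f; ring.
have -> : (dg j)%:R = toC (s j) ^+ 2 :> C.
  by rewrite -rmorphXn /= sqr_sqrt_dg rmorph_nat.
rewrite rmorphB rmorph1 /f.
have -> : \sum_k (w k j)%:R * (P i k / toC (s k)) =
   toC (s j) * (P i j - (P i j - (toC (s j))^-1 * \sum_k (w k j)%:R * f i k)).
  by rewrite subKr mulrA divff // mul1r.
by rewrite H; field.
Qed.

(** Row [i] of [P] has norm 1, so [f i] has degree-weighted norm 1. The value is [2 d_i] for [e = 1]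
    and [2 (2 - d_i)] for [e = -1], which yields [0 <= d_i <= 2] and both equality cases. *)
Lemma row_sum_sqr_difference i (e : R) : e ^+ 2 = 1 ->
  \sum_x \sum_y (w x y)%:R * `|f i x - toC e * f i y| ^+ 2 =
    toC (2 * (1 - e * (1 - d 0 i))).
Proof.
move=> e2; have H := row_eigenfunction i.
rewrite (@sum_sqr_difference _ _ w (f i) (toC e) (toC (1 - d 0 i))) //; first last.
- by rewrite -rmorphXn /= e2 rmorph1.
- by apply/complex_realP; exists e.
have -> : \sum_x (\sum_y w x y)%N%:R * `|f i x| ^+ 2 = 1.
  have /row_unitarymxP/(_ i i) := Pu.
  rewrite eqxx dotmxE mxE => E; rewrite -[RHS]E; apply: eq_bigr => k _.
  have -> : (\sum_y w k y)%N%:R = toC (s k) ^+ 2.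
    by rewrite -rmorphXn /= sqr_sqrt_dg rmorph_nat.
  have sC : (toC (s k))^* = toC (s k) by exact: conjc_real.
  rewrite !mxE normCK /f rmorphM /= fmorphV /= sC; field.
  by rewrite -(rmorph0 toC) (inj_eq (@complexI _)) sqrt_dg_neq0.
by rewrite mulr1 !(rmorphM, rmorphB, rmorph1) rmorph_nat.
Qed.

Let sum_ge0 i e : 0 <= \sum_x \sum_y (w x y)%:R * `|f i x - toC e * f i y| ^+ 2.
Proof.
by apply: sumr_ge0 => x _; apply: sumr_ge0 => y _; rewrite mulr_ge0 ?exprn_ge0.
Qed.

Lemma laplacian_eigenvalue_ge0 i : 0 <= d 0 i.
Proof.
have e2 : (1 : R) ^+ 2 = 1 by rewrite expr1n.
have := sum_ge0 i 1; rewrite row_sum_sqr_difference // ler0c.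
by lra.
Qed.

Lemma laplacian_eigenvalue_le2 i : d 0 i <= 2.
Proof.
have e2 : (-1 : R) ^+ 2 = 1 by rewrite sqrrN expr1n.
have := sum_ge0 i (-1); rewrite row_sum_sqr_difference // ler0c.
by lra.
Qed.

Let sum_eq0 i e : \sum_x \sum_y (w x y)%:R * `|f i x - toC e * f i y| ^+ 2 = 0 ->
  forall x y, (0 < w x y)%N -> f i x = toC e * f i y.
Proof.
move=> H x y wxy; apply/eqP; rewrite -subr_eq0.
have t_ge0 x' y' : 0 <= (w x' y')%:R * `|f i x' - toC e * f i y'| ^+ 2.
  by rewrite mulr_ge0 ?exprn_ge0.
have Hx : \sum_y (w x y)%:R * `|f i x - toC e * f i y| ^+ 2 = 0.
  by apply: (psumr_eq0P _ H) => // x' _; apply: sumr_ge0.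
have /eqP : (w x y)%:R * `|f i x - toC e * f i y| ^+ 2 = 0.
  by apply: (psumr_eq0P _ Hx).
by rewrite mulf_eq0 pnatr_eq0 (gtn_eqF wxy) expf_eq0 /= normr_eq0.
Qed.

Lemma eigenfunction0_const i x y : d 0 i = 0 -> (0 < w x y)%N -> f i x = f i y.
Proof.
move=> di; rewrite -[f i y]mul1r -(rmorph1 toC); apply: sum_eq0.
by rewrite row_sum_sqr_difference ?expr1n // di subr0 mulr1 subrr mulr0 rmorph0.
Qed.

Lemma eigenfunction2_alternating i x y :
  d 0 i = 2 -> (0 < w x y)%N -> f i x = - f i y.
Proof.
move=> di; rewrite -[f i y]mul1r -mulNr -(rmorph1 toC) -rmorphN; apply: sum_eq0.
rewrite row_sum_sqr_difference ?sqrrN ?expr1n // di -(rmorph0 toC); congr toC.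
by lra.
Qed.

Hypothesis connected : forall h : 'I_n -> C,
  (forall i j, (0 < w i j)%N -> h i = h j) -> forall i j, h i = h j.

Lemma eigenvector0_proportional i : d 0 i = 0 ->
  exists c, forall j, P i j = c * toC (s j).
Proof.
move=> di; have H := connected (fun x y => @eigenfunction0_const i x y di).
(* The eigenfunction is constant; its value is read at index [i] only because that index is at
   hand. *)
exists (f i i) => j; rewrite (H i j) /f divfK //.
by rewrite -(rmorph0 toC) (inj_eq (@complexI _)) sqrt_dg_neq0.
Qed.

(** Both rows are multiples of the vector of square roots of the degrees, and distinct rows of [P]
    are orthogonal unit vectors. *)
Lemma eigenvalue0_simple i j : d 0 i = 0 -> d 0 j = 0 -> i = j.
Proof.
move=> /eigenvector0_proportional[a Pi] /eigenvector0_proportional[b Pj].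
have PP k l : (row k P *m (row l P)^t*) 0 0 = (k == l)%:R.
  by rewrite -dotmxE; apply: (row_unitarymxP Pu).
pose S : C := \sum_k toC (s k) * (toC (s k))^*.
have ai : a * a^* * S = 1.
  rewrite -[RHS](congr1 (fun b : bool => b%:R : C) (eqxx i)) -PP mxE mulr_sumr.
  by apply: eq_bigr => k _; rewrite !mxE Pi rmorphM /=; ring.
have bj : b * b^* * S = 1.
  rewrite -[RHS](congr1 (fun b : bool => b%:R : C) (eqxx j)) -PP mxE mulr_sumr.
  by apply: eq_bigr => k _; rewrite !mxE Pj rmorphM /=; ring.
have abij : a * b^* * S = (i == j)%:R.
  rewrite -PP mxE mulr_sumr.
  by apply: eq_bigr => k _; rewrite !mxE Pi Pj rmorphM /=; ring.
apply/eqP; apply: contraT => /negPf ij; move: abij; rewrite ij => /eqP.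
rewrite !mulf_eq0 conjC_eq0 => /orP[/orP[]|] /eqP z0.
- by move: ai; rewrite z0 !mul0r => /eqP; rewrite eq_sym oner_eq0.
- by move: bj; rewrite z0 !mul0r => /eqP; rewrite eq_sym oner_eq0.
- by move: ai; rewrite z0 mulr0 => /eqP; rewrite eq_sym oner_eq0.
Qed.

(** The square roots of the degrees form a null vector of [M]. Some coordinate of it in the
    eigenbasis is nonzero, and there [d] must vanish. *)
Lemma eigenvalue0_exists : (0 < n)%N -> exists i, d 0 i = 0.
Proof.
move=> n0; pose v : 'rV[R]_n := \row_j s j.
have vM : v *m M = 0.
  apply/rowP => j; rewrite !mxE.
  transitivity (\sum_k (s k * (k == j)%:R - (w k j)%:R * (s j)^-1)).
    apply: eq_bigr => k _; rewrite mxE ME; field.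
    by rewrite !sqrt_dg_neq0.
  rewrite sumrB (bigD1 j) //= eqxx mulr1 big1 ?addr0; last first.
    by move=> k /negPf->; rewrite mulr0.
  rewrite -mulr_suml -natr_sum.
  have -> : (\sum_k w k j)%N = dg j by apply: eq_bigr => k _; rewrite wC.
  by rewrite -sqr_sqrt_dg expr2 mulfK ?subrr // sqrt_dg_neq0.
pose u := map_mx toC v *m P^t*.
have uD : u *m diag_mx (map_mx toC d) = 0.
  have : map_mx toC v *m map_mx toC M *m P^t* = 0.
    by rewrite -map_mxM vM map_mx0 mul0mx.
  by rewrite PE -!mulmxA (unitarymxP Pu) mulmx1 mulmxA.
have u0 : u != 0.
  apply/eqP => u0; have : map_mx toC v = 0.
    by rewrite -[LHS]mulmx1 -(unitarymxP (_ : P^t* \is unitarymx)) ?trmxC_unitary //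
      mulmxA -/u u0 mul0mx.
  move=> /rowP/(_ (Ordinal n0)); rewrite !mxE -(rmorph0 toC) => /complexI/eqP.
  by rewrite (negPf (sqrt_dg_neq0 _)).
have /rV0Pn[i ui] := u0; exists i.
move/rowP: uD => /(_ i); rewrite mul_mx_diag !mxE => /eqP.
rewrite mulf_eq0 => /orP[ui0|].
  by move: ui; rewrite mxE ui0.
by rewrite -(rmorph0 toC) (inj_eq (@complexI _)) => /eqP.
Qed.

Let pe := perm_eigenvalues Pu PE.

Let mem_eigenvalues i : d 0 i \in eigenvalues M.
Proof. by rewrite (perm_mem pe); apply/mapP; exists i; rewrite ?mem_enum. Qed.

Let eigenvaluesP a : a \in eigenvalues M -> exists i, a = d 0 i.
Proof. by rewrite (perm_mem pe) => /mapP[i _ ->]; exists i. Qed.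

Lemma eigenvalue_le_last i : d 0 i <= last 0 (eigenvalues M).
Proof.
have di := mem_eigenvalues i; rewrite -(nth_index 0 di) -nth_last.
have lt_di : (index (d 0%R i) (eigenvalues M) < size (eigenvalues M))%N.
  by rewrite index_mem.
apply: (sorted_leq_nth le_trans le_refl 0 (sorted_eigenvalues M));
  rewrite ?inE //; by case: (size _) lt_di.
Qed.

Lemma last_eigenvalue : (0 < n)%N -> exists i, d 0 i = last 0 (eigenvalues M).
Proof.
move=> n0; suff /eigenvaluesP[i ->] : last 0 (eigenvalues M) \in eigenvalues M.
  by exists i.
have := mem_eigenvalues (Ordinal n0).
by case: (eigenvalues M) => //= a l _; exact: mem_last.
Qed.

(** Otherwise the list would begin with two zeros, against the simplicity of eigenvalue 0. *)
Lemma eigenvalue1_gt0 : (1 < n)%N -> 0 < nth 0 (eigenvalues M) 1.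
Proof.
move=> n1; have sz : (1 < size (eigenvalues M))%N.
  by rewrite (perm_size pe) size_map size_enum_ord.
have := sorted_eigenvalues M; have := pe; have := eigenvaluesP.
move: sz; case: (eigenvalues M) => [//|a [//|b l]] _ ev pev /=.
move=> /andP[ab _].
have [i ai] := ev a (mem_head _ _); have a0 : 0 <= a.
  by rewrite ai laplacian_eigenvalue_ge0.
rewrite lt_neqAle (le_trans a0 ab) andbT; apply/negP => /eqP b0.
have {}a0 : a = 0 by apply/eqP; rewrite eq_le a0 b0 ab.
have : (1 < count_mem 0%R [seq d 0%R i | i : 'I_n])%N.
  by rewrite -(permP pev) /= -b0 a0 eqxx.
rewrite count_map -sum1_count big_enum_cond sum1_card => /card_gt1P.
move=> [i1 [i2 [/eqP d1 /eqP d2]]].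
by rewrite (eigenvalue0_simple d1 d2) eqxx.
Qed.

(** The list is sorted and contains 0, so a positive eigenvalue cannot stand at position 0. *)
Lemma eigenvalue1_le i : d 0 i != 0 -> nth 0 (eigenvalues M) 1 <= d 0 i.
Proof.
move=> di; have dp : 0 < d 0 i by rewrite lt_neqAle eq_sym di laplacian_eigenvalue_ge0.
have [i0 d0] := eigenvalue0_exists (leq_ltn_trans (leq0n i) (ltn_ord i)).
have i_in := mem_eigenvalues i; have := mem_eigenvalues i0; rewrite d0 => l0.
have nth_le := sorted_leq_nth le_trans le_refl 0 (sorted_eigenvalues M).
rewrite -[leRHS](nth_index 0 i_in); apply: (nth_le); rewrite ?inE ?index_mem //.
  rewrite (perm_size pe) size_map size_enum_ord.
  have : i != i0 by apply: contraNneq di => ->; rewrite d0.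
  by move: (ltn_ord i) (ltn_ord i0); rewrite -val_eqE /=; lia.
rewrite lt0n; apply/eqP => k0; move: dp; rewrite -(nth_index 0 i_in) k0 => /lt_geF.
rewrite -[X in _ <= X](nth_index 0 l0).
by rewrite nth_le ?inE ?index_mem // -has_predT; apply/hasP; exists 0.
Qed.

End Decomposition.

(** * Bounds on the first non-trivial and the last eigenvalue, and the contraction *)

Hypothesis connected : forall h : 'I_n -> C,
  (forall i j, (0 < w i j)%N -> h i = h j) -> forall i j, h i = h j.

Local Notation ev1 := (nth 0 (eigenvalues M) 1).
Local Notation evmax := (last 0 (eigenvalues M)).

Lemma lambda1_gt0 : (1 < n)%N -> 0 < ev1.
Proof.
have [P [d [Pu PE]]] := symmetric_spectral normalized_laplacian_sym.
exact: (eigenvalue1_gt0 Pu PE).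
Qed.

Lemma lambda1_le_lambda_max : (1 < n)%N -> ev1 <= evmax.
Proof.
move=> n1; have [P [d [Pu PE]]] := symmetric_spectral normalized_laplacian_sym.
have pe := perm_eigenvalues Pu PE.
have sz : size (eigenvalues M) = n.
  by rewrite (perm_size pe) size_map size_enum_ord.
have : ev1 \in eigenvalues M by rewrite mem_nth // sz.
by rewrite (perm_mem pe) => /mapP[i _ ->]; apply: eigenvalue_le_last Pu PE i.
Qed.

Lemma lambda_max_le2 : (1 < n)%N -> evmax <= 2.
Proof.
move=> n1; have [P [d [Pu PE]]] := symmetric_spectral normalized_laplacian_sym.
have [i <-] := last_eigenvalue Pu PE (ltnW n1).
exact: laplacian_eigenvalue_le2 Pu PE i.
Qed.

(** An eigenvalue 2 would give an eigenfunction that changes sign along every edge. The assumption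
    makes it zero, while a row of [P] has norm 1. *)
Lemma lambda_max_lt2 : (1 < n)%N ->
  (forall h : 'I_n -> C, (forall i j, (0 < w i j)%N -> h i = - h j) ->
    forall i, h i = 0) -> evmax < 2.
Proof.
move=> n1 nonbip; rewrite lt_neqAle lambda_max_le2 // andbT; apply/negP => /eqP m2.
have [P [d [Pu PE]]] := symmetric_spectral normalized_laplacian_sym.
have [i di] := last_eigenvalue Pu PE (ltnW n1); rewrite m2 in di.
have H := nonbip _ (fun x y => @eigenfunction2_alternating P d Pu PE i x y di).
have := row_unitarymxP Pu i i; rewrite eqxx dotmxE mxE big1 => [/eqP|k _].
  by rewrite eq_sym oner_eq0.
have /eqP := H k; rewrite mulf_eq0 invr_eq0 -(rmorph0 toC).
rewrite (inj_eq (@complexI _)) (negPf (sqrt_dg_neq0 k)) orbF !mxE => /eqP->.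
by rewrite rmorph0 mul0r.
Qed.

Lemma lazy_contraction (c : R) (g : 'rV[R]_n) : 0 <= c ->
  \sum_j g 0 j * s j = 0 ->
  euclid_norm (g *m (1%:M - c *: M)) <=
    Num.max `|1 - c * ev1| `|c * evmax - 1| * euclid_norm g.
Proof.
move=> c0 g0; have [P [d [Pu PE]]] := symmetric_spectral normalized_laplacian_sym.
apply: (contraction Pu PE); first by rewrite le_max normr_ge0.
move=> i; have [di|di] := eqVneq (d 0 i) 0; [right|left].
  have [a Pa] := eigenvector0_proportional Pu PE connected di.
  transitivity (a^* * toC (\sum_j g 0 j * s j)); last by rewrite g0 rmorph0 mulr0.
  rewrite rmorph_sum mulr_sumr; apply: eq_bigr => j _.
  have sC : (toC (s j))^* = toC (s j) by exact: conjc_real.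
  by rewrite Pa !rmorphM /= sC; ring.
have lo := ler_wpM2l c0 (eigenvalue1_le Pu PE di).
have hi := ler_wpM2l c0 (eigenvalue_le_last Pu PE i).
(* A nonnegative factor is bounded through [ev1], a negative one through [evmax]. *)
rewrite le_max; have [p|p] := leP 0 (1 - c * d 0 i).
  apply/orP; left; rewrite (ger0_norm p) ger0_norm; lra.
apply/orP; right; rewrite (ltr0_norm p) ger0_norm; lra.
Qed.

End Graph.

(** * The lazy random walk on the stops *)

(* Imported only here: all_classical and finmap shadow subsetP, setDE, inE, etc.,
   whose finset versions are used above. *)
From mathcomp Require Import all_classical all_reals all_analysis.
Import numFieldNormedType.Exports.

Local Open Scope classical_set_scope.

Section Walk.
Variables (R : realType) (V : finType) (r s : nat) (E : {set {set V}}).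
Local Notation N := #|{: stops V s}|.
Local Notation C := R[i]%C.
Hypotheses (sr : (s.*2 <= r)%N) (Er : r_uniform E r) (Ec : s_connected E r s).
Hypothesis N_gt1 : (1 < N)%N.

Let w (i j : 'I_N) : nat := weight E (enum_val i) (enum_val j).
Let deg (i : 'I_N) : nat := degree E (enum_val i).
Let sq (i : 'I_N) : R := Num.sqrt (deg i)%:R.
Let D : nat := (\sum_(y : stops V s) degree E y)%N.
Let S := inv_sqrt_degree_mx R E s.
Let L := laplacian R E s.
Let pi_ := stationary R E s.

Lemma degE i : deg i = (\sum_j w i j)%N.
Proof. by rewrite /deg /degree (big_enum_val (fun y => weight E (enum_val i) y)). Qed.

Lemma deg_gt0 i : (0 < deg i)%N.
Proof.
have [y wy] := connected_neighbor (enum_val i) sr Er Ec N_gt1.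
exact: degree_gt0 wy.
Qed.

Lemma sum_w_gt0 i : (0 < \sum_j w i j)%N.
Proof. by rewrite -degE deg_gt0. Qed.

Lemma w_sym i j : w i j = w j i. Proof. exact: weight_sym. Qed.

Lemma sq_gt0 i : 0 < sq i. Proof. by rewrite sqrtr_gt0 ltr0n deg_gt0. Qed.

Lemma sqr_sq i : sq i ^+ 2 = (deg i)%:R. Proof. by rewrite sqr_sqrtr ?ler0n. Qed.

Lemma laplacianE i j : L i j = (i == j)%:R -
  (Num.sqrt (\sum_k w i k)%N%:R)^-1 * (w i j)%:R * (Num.sqrt (\sum_k w j k)%N%:R)^-1.
Proof.
rewrite /L /laplacian /inv_sqrt_degree_mx mul_mx_diag mul_diag_mx !mxE.
by rewrite -!degE.
Qed.

Lemma w_connected (T : Type) (h : 'I_N -> T) :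
  (forall i j, (0 < w i j)%N -> h i = h j) -> forall i j, h i = h j.
Proof.
move=> hE i j.
have := connected_const (h := fun x => h (enum_rank x)) sr Er Ec.
move=> /(_ _ (enum_val i) (enum_val j)); rewrite !enum_valK; apply=> x y wxy.
by apply: hE; rewrite /w !enum_rankK.
Qed.

Lemma transitionE (alpha : R) i j :
  transition_mx E r s alpha i j =
    alpha * (i == j)%:R + (1 - alpha) * ((w i j)%:R / (deg i)%:R).
Proof.
by rewrite mxE /lazy_step_prob step_probE ?deg_gt0 // (inj_eq enum_val_inj).
Qed.

Lemma transition_row_sum (alpha : R) i : \sum_j transition_mx E r s alpha i j = 1.
Proof.
under eq_bigr do rewrite transitionE.
rewrite big_split /= -!mulr_sumr -mulr_suml.
rewrite -[X in _ * (X / _)]natr_sum -degE.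
rewrite divff ?pnatr_eq0 -?lt0n ?deg_gt0 // (bigD1 i) //= eqxx big1 ?addr0.
  by rewrite !mulr1 subrKC.
by move=> k /negPf; rewrite eq_sym => ->.
Qed.

Lemma sum_mul_transition (alpha : R) (f : 'rV[R]_N) :
  \sum_j (f *m transition_mx E r s alpha) 0 j = \sum_j f 0 j.
Proof.
under eq_bigr do rewrite mxE.
rewrite exchange_big /=; apply: eq_bigr => i _.
by rewrite -mulr_sumr transition_row_sum mulr1.
Qed.

Lemma D_neq0 : D%:R != 0 :> R.
Proof.
rewrite pnatr_eq0 -lt0n; have i0 : 'I_N := Ordinal (ltnW N_gt1).
by rewrite /D (bigD1 (enum_val i0)) //= addn_gt0 (deg_gt0 i0).
Qed.

(** Reversibility: the flow [pi_i w_ij / deg_i = w_ij / D] is symmetric in [i] and [j], so summing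
    over [i] gives [deg_j / D]. *)
Lemma stationary_transition (alpha : R) : pi_ *m transition_mx E r s alpha = pi_.
Proof.
apply/rowP => j; rewrite !mxE.
transitivity (\sum_i (alpha * ((deg i)%:R / D%:R * (i == j)%:R) +
  (1 - alpha) * ((w j i)%:R / D%:R)) : R).
  apply: eq_bigr => i _; rewrite transitionE !mxE -/(deg i) -/D w_sym.
  have di : (deg i)%:R != 0 :> R by rewrite pnatr_eq0 -lt0n deg_gt0.
  by field; rewrite di D_neq0.
rewrite big_split /= -!mulr_sumr -mulr_suml -natr_sum -degE.
rewrite (bigD1 j) //= eqxx big1 => [|i /negPf->]; last by rewrite mulr0.
by rewrite addr0 mulr1 -mulrDl subrKC mul1r.
Qed.

Lemma sum_stationary : \sum_i pi_ 0 i = 1.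
Proof.
under eq_bigr do rewrite mxE -/(deg _) -/D.
rewrite -mulr_suml -natr_sum.
have -> : (\sum_i deg i)%N = D.
  by rewrite /D (big_enum_val (fun y => degree E y)).
by rewrite divff // D_neq0.
Qed.

(** The transition matrix is [alpha I + (1 - alpha) T^(-1) A], and [S = T^(-1/2)] conjugates
    [T^(-1) A] into [I - L]. *)
Lemma transition_conj (alpha : R) :
  transition_mx E r s alpha *m S = S *m (1%:M - (1 - alpha) *: L).
Proof.
rewrite /S /inv_sqrt_degree_mx mul_mx_diag mul_diag_mx; apply/matrixP => i j.
have BE (A : 'M[R]_N) c : (1%:M - c *: A) i j = (i == j)%:R - c * A i j.
  by rewrite !mxE.
rewrite [LHS]mxE [RHS]mxE BE transitionE laplacianE -!degE !mxE -/(deg i) -/(deg j) -/(sq i) -/(sq j).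
rewrite -sqr_sq.
have si : sq i != 0 by rewrite gt_eqF ?sq_gt0.
have sj : sq j != 0 by rewrite gt_eqF ?sq_gt0.
by case: (i =P j) => [<-|_] /=; field; rewrite ?si ?sj.
Qed.

(** * Decay of the deviation from the stationary distribution *)

Variables (alpha : R) (f0 : 'rV[R]_N).
Hypotheses (alpha_ge0 : 0 <= alpha) (alpha_lt1 : alpha < 1).
Hypothesis f0_distribution : is_distribution f0.
Local Notation f := (stop_distribution E r alpha f0).
Let g k := (f k - pi_) *m S.

Lemma deviation_step k : g k.+1 = g k *m (1%:M - (1 - alpha) *: L).
Proof.
rewrite /g -!mulmxA -transition_conj mulmxA [in RHS]mulmxBl.
by rewrite stationary_transition.
Qed.

(** The factors [sq j] undo [T^(-1/2)], leaving the total mass [1 - 1] of [f k - pi_]. *)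
Lemma deviation_orthogonal k : \sum_j g k 0 j * sq j = 0.
Proof.
have fk : \sum_j f k 0 j = 1.
  elim: k => [|k IHk]; first by case: f0_distribution.
  by rewrite /stop_distribution iterS sum_mul_transition.
transitivity (\sum_j (f k 0 j - pi_ 0 j)); last by rewrite sumrB fk sum_stationary subrr.
apply: eq_bigr => j _; rewrite /g /S mul_mx_diag !mxE -/(deg j) -/(sq j).
by rewrite divfK // gt_eqF ?sq_gt0.
Qed.

Lemma deviation_le k : euclid_norm (g k) <= lambda_bar E s alpha ^+ k * euclid_norm (g 0%N).
Proof.
elim: k => [|k IHk]; first by rewrite mul1r.
rewrite deviation_step exprS -mulrA.
have a0 : 0 <= 1 - alpha by rewrite subr_ge0 ltW.
have orth : \sum_j g k 0 j * Num.sqrt (\sum_l w j l)%N%:R = 0.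
  by rewrite -[RHS](deviation_orthogonal k); apply: eq_bigr => j _; rewrite -degE.
apply: (le_trans (lazy_contraction w_sym sum_w_gt0 laplacianE (@w_connected _) a0 orth)).
by apply: ler_wpM2l => //; rewrite le_max normr_ge0.
Qed.

(** This returns from the weighted norm to single probabilities, at the cost of a factor independent
    of [k]. *)
Lemma deviation_coordinate k i : `|f k 0 i - pi_ 0 i| <= sq i * euclid_norm (g k).
Proof.
have gi : f k 0 i - pi_ 0 i = sq i * g k 0 i.
  rewrite /g /S mul_mx_diag !mxE -/(deg i) -/(sq i) [RHS]mulrC divfK //.
  by rewrite gt_eqF ?sq_gt0.
rewrite gi normrM gtr0_norm ?sq_gt0 // ler_wpM2l ?(ltW (sq_gt0 i)) //.
rewrite -sqrtr_sqr /euclid_norm; apply: ler_wsqrtr; rewrite (bigD1 i) //= lerDl.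
by apply: sumr_ge0 => j _; exact: sqr_ge0.
Qed.

(** The chain [0 < (1 - alpha) lambda_1 <= (1 - alpha) lambda_max < 2] keeps both absolute values
    below 1; only its last inequality depends on the excluded case. *)
Lemma lambda_bar_lt1 :
  ~ [/\ alpha = 0, r = s.*2 & lambda_max R E s = 2] -> lambda_bar E s alpha < 1.
Proof.
move=> exc.
have l1 : 0 < lambda1 R E s.
  exact: lambda1_gt0 w_sym sum_w_gt0 laplacianE (@w_connected _) N_gt1.
have l1m : lambda1 R E s <= lambda_max R E s.
  exact: lambda1_le_lambda_max w_sym laplacianE N_gt1.
have lm : lambda_max R E s <= 2.
  exact: lambda_max_le2 w_sym sum_w_gt0 laplacianE N_gt1.
have lt2 : (1 - alpha) * lambda_max R E s < 2.
  have [a0|a0] := eqVneq alpha 0; last first.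
    have {a0} a0 : 0 < alpha by rewrite lt_neqAle eq_sym a0.
    by nra.
  (* If [lambda_max = 2], then [r > 2s] is refuted by [not_alternating], and [r = 2s] is the
     excluded case. *)
  rewrite a0 subr0 mul1r lt_neqAle lm andbT; apply/eqP => lm2.
  apply: exc; split=> //; apply/eqP; rewrite eqn_leq sr andbT leqNgt.
  apply/negP => sr'; suff : lambda_max R E s < 2 by rewrite lm2 ltxx.
  apply: (lambda_max_lt2 w_sym sum_w_gt0 laplacianE N_gt1) => h hE i.
  have := @not_alternating _ E r s C (fun x => h (enum_rank x)) sr' Er.
  move=> /(_ _ _ (enum_val i)); rewrite enum_valK; apply=> x.
    exact: connected_neighbor sr Er Ec N_gt1.
  by move=> y wxy; apply: hE; rewrite /w !enum_rankK.
have a0 : 0 < 1 - alpha by rewrite subr_gt0.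
have p1 := mulr_gt0 a0 l1; have p2 := ler_wpM2l (ltW a0) l1m.
by rewrite /lambda_bar gt_max !ltr_norml; apply/andP; split; apply/andP; split; lra.
Qed.

Lemma stop_distribution_cvg i : lambda_bar E s alpha < 1 ->
  f k 0 i @[k --> \oo] --> pi_ 0 i.
Proof.
move=> lb1; apply/subr_cvg0; apply: norm_cvg0.
pose c := sq i * euclid_norm (g 0%N).
apply: (@squeeze_cvgr _ _ _ _ (fun=> 0) (fun k => c * lambda_bar E s alpha ^+ k)).
- near=> k; rewrite normr_ge0 /=; apply: (le_trans (deviation_coordinate k i)).
  by rewrite /c -mulrA ler_wpM2l ?(ltW (sq_gt0 i)) // mulrC deviation_le.
- exact: cvg_cst.
- rewrite -[0](mulr0 c); apply: cvgM; first exact: cvg_cst.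
  by apply: cvg_expr; rewrite ger0_norm // le_max normr_ge0.
Unshelve. all: by end_near. Qed.

End Walk.

(** On the finite set of stops convergence is stated coordinatewise. If [alpha = 0] and
    [lambda_max = 2], then [G^(s)] is bipartite and a walk from a single stop oscillates between the
    two classes, so this case is excluded from the limit but not from the inequality. *)
Theorem theorem9 (R : realType) (V : finType) (r s : nat)
  (E : {set {set V}}) (alpha : R) (f0 : 'rV[R]_(#|{: stops V s}|))
  (s_gt0 : (1 <= s)%N) (s_le : (s.*2 <= r)%N)
  (E_uniform : r_uniform E r)
  (E_connected : s_connected E r s)
  (lambda1_exists : (1 < #|{: stops V s}|)%N)
  (alpha_ge0 : 0 <= alpha) (alpha_lt1 : alpha < 1)
  (f0_distribution : is_distribution f0) :
  (~ [/\ alpha = 0, r = s.*2 & lambda_max R E s = 2] ->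
   forall i : 'I_(#|{: stops V s}|),
     (stop_distribution E r alpha f0 k 0 i @[k --> \oo]
        --> stationary R E s 0 i)) /\
  (forall k : nat,
     euclid_norm ((stop_distribution E r alpha f0 k - stationary R E s)
                    *m inv_sqrt_degree_mx R E s)
     <= lambda_bar E s alpha ^+ k *
        euclid_norm ((f0 - stationary R E s) *m inv_sqrt_degree_mx R E s)).
Proof.
split=> [exc i|k]; last exact: deviation_le.
by apply: (stop_distribution_cvg s_le E_uniform E_connected) => //;
  apply: (lambda_bar_lt1 s_le E_uniform E_connected).
Qed.
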